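(* Let $A$ be a finite set of nonnegative integers with $|A| < 6$. Then $A$ is not sum-dominant, i.e. it is not the case that $|A+A| > |A-A|$.
   Context: For a set $A$ of nonnegative integers, define $A+A = \{a+a' \mid a,a'\in A\}$ and $A-A=\{a-a' \mid a,a'\in A\}$ (the latter is a set of integers, containing both positive and negative differences). The set $A$ is called sum-dominant if $|A+A|>|A-A|$. *)

(* Defs.v *)
From mathcomp Require Import all_boot all_order all_algebra.
From mathcomp Require Import finmap.

Set Implicit Arguments.
Unset Strict Implicit.
Unset Printing Implicit Defensive.

Local Open Scope fset_scope.

Definition sumset (A : {fset nat}) : {fset nat} :=
  [fset (a + a')%N | a in A, a' in A].

(* The difference is taken in int: subtraction on nat is truncated. *)
Definition diffset (A : {fset nat}) : {fset int} :=
  [fset (a%:Z - a'%:Z)%R | a in A, a' in A].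

Definition sum_dominant (A : {fset nat}) : Prop :=
  (#|` diffset A| < #|` sumset A|)%N.

(* Main.v *)
Require Import Defs.
From mathcomp Require Import all_boot all_order all_algebra.
From mathcomp Require Import finmap.
From mathcomp Require Import zify.

(** Write [n] for the size of [A], [S] for that of [A + A] and [D] for that of
    [A - A]. The sums are indexed by the n(n+1)/2 unordered pairs of [A], and the
    differences by the n(n-1) ordered pairs of distinct elements, together with
    the value 0. The point is that a coincidence of differences
    [i - j = k - l] is also a coincidence of sums [i + l = k + j], so a set
    with few coincidences among its sums has few among its differences.

    If all sums are distinct, so are all differences and D = n(n-1) + 1
    ([card_diffset_sidon]). If S is one less than its maximum, there is exactly
    one coincidence of sums, which accounts for at most two coincidences of
    differences and their opposites, so D >= n(n-1) - 3
    ([card_diffset_one_collision]). For n < 6 these bounds force a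
    sum-dominant set to have S at most n(n+1)/2 - 1, and at most n(n+1)/2 - 2
    if n is 4 or 5 ([card_sumset_sum_dominant]). The differences with the least
    element give D >= 2n - 1, which settles n <= 3.

    For n = 4 this leaves D = 7 and S <= 8, but D = 7 makes [A] an arithmetic
    progression ([progression4]), so that S = 7. For n = 5 it leaves D < S <= 13, so
    at most five positive differences. Up to translation, dilation and
    reflection, [A] is then one of {0,1,2,3,4}, {0,1,2,3,5}, {0,1,2,4,5} and
    {0,2,3,4,6}, all with S <= 11 ([card_sumset5]). Hence D <= 10, [A] is an
    arithmetic progression ([progression5]) and S = 9 <= D. *)

Set Implicit Arguments.
Unset Strict Implicit.
Unset Printing Implicit Defensive.

Local Open Scope fset_scope.

(** * Coincidences of a function on a finite set *)

Lemma card_fset_square (T : choiceType) (A : {fset T}) :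
  #|` A `*` A| = (#|` A| * #|` A|)%N.
Proof.
rewrite (perm_size (enum_imfset2 _ _)) ?size_allpairs //.
by move=> [x y] [x' y'] _ _ /= [-> ->].
Qed.

(** Two different coincidences cost two values: if [x'] is neither [x] nor [y],
    then dropping both [x] and [x'] from [U] loses no value of [f], because [y]
    and [y'] (or [y] alone, when [y' = x]) take their place. *)
Lemma unique_collision {T R : choiceType} {f : T -> R} {U : {fset T}}
    {x y x' y' : T} :
  (#|` U| <= #|` f @` U| + 1)%N ->
  x \in U -> y \in U -> x <> y -> f x = f y ->
  x' \in U -> y' \in U -> x' <> y' -> f x' = f y' ->
  x' = x \/ x' = y.
Proof.
move=> hU xU yU nxy fxy x'U y'U nxy' fxy'.
have [->|/eqP nx] := eqVneq x' x; first by left.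
have [->|/eqP ny] := eqVneq x' y; first by right.
have sub : f @` U `<=` f @` (U `\ x `\ x').
  apply/fsubsetP => _ /imfsetP [z /= zU ->].
  suff [w [wU -> /eqP nw /eqP nw']] :
      exists w, [/\ w \in U, f z = f w, w <> x & w <> x'].
    by apply/imfsetP; exists w => //=; rewrite !inE wU nw nw'.
  have [->|/eqP zx] := eqVneq z x.
    by exists y; split=> // e; [apply: nxy | apply: ny].
  have [->|/eqP zx'] := eqVneq z x'; last by exists z.
  have [e|/eqP ?] := eqVneq y' x; last by exists y'; split=> // e; apply: nxy'.
  exists y; split=> //; first by rewrite fxy' e.
    by move=> e'; apply: nxy.
  by move=> e'; apply: ny.
have := leq_trans (fsubset_leq_card sub) (leq_imfset_card _ _ _).
rewrite /= => h.
have := cardfsD1 x U; have := cardfsD1 x' (U `\ x).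
rewrite !inE xU x'U (introN eqP nx) /=; lia.
Qed.

Lemma injective_or_collision {T R : choiceType} (f : T -> R) (U : {fset T}) :
  {in U &, injective f} \/
  exists x y, [/\ x \in U, y \in U, x <> y & f x = f y].
Proof.
have [/hasP [x xU /hasP [y yU /andP [/eqP ? /eqP ?]]]|/hasPn H] :=
  boolP (has (fun x => has (fun y => (x != y) && (f x == f y)) U) U).
  by right; exists x, y.
left=> x y xU yU e; apply/eqP/negPn/negP => ne.
by move: (H x xU) => /hasPn /(_ y yU) /=; rewrite ne e eqxx.
Qed.

(** * Pairs, sums and differences *)

(** Unordered pairs, each represented by its increasing ordering. *)
Definition upairs (A : {fset nat}) : {fset nat * nat} :=
  [fset p in A `*` A | (p.1 <= p.2)%N].

Definition offdiag (A : {fset nat}) : {fset nat * nat} :=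
  [fset p in A `*` A | p.1 != p.2].

(** [upairs A] and its mirror image cover the square and meet in the diagonal. *)
Lemma card_upairs A : (2 * #|` upairs A| = #|` A| * (#|` A|).+1)%N.
Proof.
pose sw (p : nat * nat) := (p.2, p.1).
have swK : injective sw by move=> [a b] [c d] [-> ->].
have E1 : upairs A `|` sw @` upairs A = A `*` A.
  apply/fsetP => -[a b]; rewrite !inE /=.
  have -> : ((a, b) \in sw @` upairs A) = ((b, a) \in upairs A).
    by rewrite -[(a, b)]/(sw (b, a)) (mem_imfset _ _ swK).
  rewrite !inE /=; lia.
have E2 : upairs A `&` sw @` upairs A = (fun a => (a, a)) @` A.
  apply/fsetP => -[a b]; rewrite !inE /=.
  have -> : ((a, b) \in sw @` upairs A) = ((b, a) \in upairs A).
    by rewrite -[(a, b)]/(sw (b, a)) (mem_imfset _ _ swK).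
  rewrite !inE /=; apply/idP/imfsetP => /= [h|[c cA [-> ->]]]; last by rewrite cA leqnn.
  by exists a; [lia | congr pair; lia].
have := cardfsUI (upairs A) (sw @` upairs A).
rewrite E1 E2 card_fset_square (card_imfset _ _ swK) card_imfset /= => [|a b []] //.
lia.
Qed.

Lemma card_offdiag A : (#|` A| * #|` A| = #|` offdiag A| + #|` A|)%N.
Proof.
rewrite -card_fset_square -(cardfsID (offdiag A)); congr addn.
  by congr size; congr enum_fset; apply/fsetIidPr/fsubsetP => p; rewrite !inE => /andP[].
have dinj : injective (fun a : nat => (a, a)) by move=> a b [].
have -> : A `*` A `\` offdiag A = (fun a => (a, a)) @` A.
  apply/fsetP => -[a b]; rewrite !inE /=.
  apply/idP/imfsetP => /= [h|[c cA [-> ->]]]; last by rewrite cA eqxx.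
  by exists a; [lia | congr pair; lia].
by rewrite card_imfset.
Qed.

Definition sum_of (p : nat * nat) : nat := (p.1 + p.2)%N.
Definition diff_of (p : nat * nat) : int := (p.1%:Z - p.2%:Z)%R.
Definition spair (u v : nat) : nat * nat := (minn u v, maxn u v).

Lemma spair_in_upairs A u v : u \in A -> v \in A -> spair u v \in upairs A.
Proof.
by move=> uA vA; rewrite !inE /= /minn /maxn; case: ltnP => h; rewrite uA vA /= ?h // ltnW.
Qed.

Lemma spair_inj u v s t : spair u v = spair s t -> (u = s /\ v = t) \/ (u = t /\ v = s).
Proof. move=> [] *; lia. Qed.

Lemma spair_id {u v} : (u <= v)%N -> spair u v = (u, v).
Proof. by move=> uv; rewrite /spair (minn_idPl uv) (maxn_idPr uv). Qed.

Lemma sum_spair u v : sum_of (spair u v) = (u + v)%N.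
Proof. rewrite /sum_of /=; lia. Qed.

Lemma sumsetE A : sumset A = sum_of @` upairs A.
Proof.
apply/fsetP => z; apply/imfset2P/imfsetP => /= [[a aA [b bA ->]]|[[a b] /= h ->]].
  by exists (spair a b); [exact: spair_in_upairs | rewrite sum_spair].
by move: h; rewrite !inE /= => /andP[/andP[aA bA] _]; exists a => //; exists b.
Qed.

(** The extra 1 is the difference 0, which no off-diagonal pair produces. *)
Lemma card_diffset_ge A (bad : {fset nat * nat}) : A != fset0 ->
  {in offdiag A `\` bad &, injective diff_of} ->
  (#|` offdiag A| + 1 <= #|` diffset A| + #|` bad|)%N.
Proof.
move=> /fset0Pn [a aA] inj.
have sub : Posz 0 |` diff_of @` (offdiag A `\` bad) `<=` diffset A.
  apply/fsubsetP => z; rewrite !inE => /orP[/eqP->|].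
    by apply/imfset2P; exists a => //; exists a => //; lia.
  move=> /imfsetP [[b c] /=]; rewrite !inE /= => /and3P[_ /andP[bA cA] _] ->.
  by apply/imfset2P; exists b => //; exists c.
have := fsubset_leq_card sub; rewrite cardfsU1 card_in_imfset //=.
have -> : (Posz 0 \notin diff_of @` (offdiag A `\` bad)).
  apply/imfsetP => -[[b c] /=]; rewrite !inE /= /diff_of /= => h1 h2; lia.
have hI := fsubset_leq_card (fsubsetIr (offdiag A) bad).
rewrite cardfsD /= add1n => hlt.
apply: leq_trans (leq_add hlt hI); rewrite addSn addn1 ltnS.
by rewrite addnC -leq_subLR.
Qed.

Lemma mem_offdiag {A i j} : (i, j) \in offdiag A -> [/\ i \in A, j \in A & i != j].
Proof. by rewrite !inE => /andP[/andP[]]. Qed.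

(** Rearranging [i - j = k - l] as [i + l = k + j]. The two unordered pairs are
    different: [i = k] and [l = j] would make the two ordered pairs equal, and
    [i = j] is excluded. *)
Lemma collision_diff_sum A i j k l :
  (i, j) \in offdiag A -> (k, l) \in offdiag A -> diff_of (i, j) = diff_of (k, l) ->
  (i, j) <> (k, l) ->
  [/\ spair i l \in upairs A, spair k j \in upairs A, spair i l <> spair k j
    & sum_of (spair i l) = sum_of (spair k j)].
Proof.
move=> /mem_offdiag [iA jA nij] /mem_offdiag [kA lA nkl]; rewrite /diff_of /= => e ne.
split; try exact: spair_in_upairs; last by rewrite !sum_spair; lia.
move=> /spair_inj [[? ?]|[? ?]]; first by subst; apply: ne; congr pair; lia.
lia.
Qed.

(** * Sets with almost all sums distinct *)

Lemma card_diffset_sidon A : A != fset0 -> (#|` upairs A| <= #|` sumset A|)%N ->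
  (#|` offdiag A| + 1 <= #|` diffset A|)%N.
Proof.
move=> A0; rewrite sumsetE => hS.
have /card_in_imfsetP inj : #|` sum_of @` upairs A| == #|` upairs A|.
  by rewrite eqn_leq hS andbT leq_imfset_card.
rewrite -[leqRHS]addn0 -(@cardfs0 (nat * nat)%type); apply: card_diffset_ge => //.
rewrite fsetD0 => -[i j] [k l] hij hkl e; apply/eqP/negPn/negP => /eqP ne.
have [h1 h2 n12 e12] := collision_diff_sum hij hkl e ne.
by apply: n12; apply: inj.
Qed.

(** Let [u + v = s + t] be the only coincidence of sums. It is the rearrangement
    of [u - s = t - v], of [u - t = s - v] and of their opposites. The four pairs
    joining [u] to [s] and [t] meet each of these, and without them the
    differences are distinct. *)
Lemma card_diffset_one_collision A : A != fset0 ->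
  (#|` upairs A| <= #|` sumset A| + 1)%N ->
  (#|` offdiag A| + 1 <= #|` diffset A| + 4)%N.
Proof.
move=> A0; rewrite sumsetE => hS.
have [inj|[[u v] [[s t] [pU qU npq epq]]]] := injective_or_collision sum_of (upairs A).
  apply: leq_trans (card_diffset_sidon A0 _) (leq_addr _ _).
  by rewrite sumsetE (eqP (introT (card_in_imfsetP _ _) inj)).
pose bad := [fset (u, s); (u, t); (s, u); (t, u)].
have bad4 : (#|` bad| <= 4)%N.
  by rewrite /bad !cardfsU !cardfs1; lia.
suff inj : {in offdiag A `\` bad &, injective diff_of}.
  have := card_diffset_ge A0 inj; lia.
move=> [i j] [k l]; rewrite !in_fsetD => /andP[nij hij] /andP[nkl hkl] e.
apply/eqP/negPn/negP => /eqP ne.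
have [h1 h2 n12 e12] := collision_diff_sum hij hkl e ne.
have c1 := unique_collision hS pU qU npq epq h1 h2 n12 e12.
have c2 := unique_collision hS pU qU npq epq h2 h1 (nesym n12) (esym e12).
have uv : (u <= v)%N by move: pU; rewrite !inE => /andP[].
have st : (s <= t)%N by move: qU; rewrite !inE => /andP[].
rewrite -(spair_id uv) -(spair_id st) in c1 c2.
rewrite !inE !xpair_eqE in nij nkl.
case: c1 => c1; case: c2 => c2; try by rewrite c1 c2 in n12.
all: by case/spair_inj: c1 => -[? ?]; case/spair_inj: c2 => -[? ?]; subst;
  rewrite ?eqxx ?orbT in nij nkl.
Qed.

(** * Sets with few differences *)

(** Distinct positive differences count twice, because [A - A] is symmetric,
    and 0 is one more. The nat subtraction is exact on increasing pairs. *)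
Lemma diffset_ge_pairs {A : {fset nat}} (ps : seq (nat * nat)) : A != fset0 ->
  all (fun p => [&& p.1 \in A, p.2 \in A & (p.1 < p.2)%N]) ps ->
  uniq [seq (p.2 - p.1)%N | p <- ps] ->
  ((size ps).*2 < #|` diffset A|)%N.
Proof.
move=> /fset0Pn [a aA] /allP psA; set l := map _ ps => ul.
pose pos := [seq Posz d | d <- l]; pose neg := [seq (- Posz d)%R | d <- l].
have l0 d : d \in l -> (0 < d)%N.
  by move=> /mapP [p /psA /and3P [_ _ ?] ->]; rewrite subn_gt0.
have -> : (size ps).*2.+1 = size (Posz 0 :: pos ++ neg).
  by rewrite /= size_cat !size_map addnn.
apply: uniq_leq_size.
  rewrite /= mem_cat cat_uniq.
  have -> : uniq pos by rewrite map_inj_uniq // => x y [].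
  have -> : uniq neg by rewrite map_inj_uniq // => x y; lia.
  rewrite andbT /=; apply/andP; split.
    apply/norP; split; apply/mapP => -[d /l0 d0]; lia.
  by apply/hasPn => _ /mapP [d /l0 d0 ->]; apply/mapP => -[d' /l0 d0']; lia.
move=> z; rewrite inE mem_cat => /orP[/eqP->|/orP[]].
- by apply/imfset2P; exists a => //; exists a => //; lia.
- move=> /mapP [_ /mapP [[u v] /psA /and3P /= [? ? ?] ->] ->].
  by apply/imfset2P; exists v => //; exists u => //; lia.
- move=> /mapP [_ /mapP [[u v] /psA /and3P /= [? ? ?] ->] ->].
  by apply/imfset2P; exists u => //; exists v => //; lia.
Qed.

(** The bound can be computed for an explicit [s]: this reduces counting sums to
    the pattern of the set up to translation and dilation. *)
Lemma card_sumset_affine (A : {fset nat}) a x (s : seq nat) :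
  A =i [seq (a + x * i)%N | i <- s] ->
  (#|` sumset A| <= size (undup [seq (i + j)%N | i <- s, j <- s]))%N.
Proof.
move=> AE; set l := undup _; rewrite -(size_map (fun t => a.*2 + x * t)%N l).
apply: uniq_leq_size => [|z]; first exact: fset_uniq.
move=> /imfset2P [u uA [v vA ->]].
have /mapP [i si ->] : u \in [seq a + x * i | i <- s]%N by rewrite -AE.
have /mapP [j sj ->] : v \in [seq a + x * i | i <- s]%N by rewrite -AE.
apply/mapP; exists (i + j)%N; last by lia.
by rewrite mem_undup; apply: allpairs_f.
Qed.

Lemma fset_sorted (A : {fset nat}) :
  exists s, [/\ sorted ltn s, size s = #|` A| & A =i s].
Proof.
exists (sort leq A); split; last by move=> x; rewrite mem_sort.
  by rewrite ltn_sorted_uniq_leq sort_uniq fset_uniq sort_sorted //; apply: leq_total.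
by rewrite size_sort.
Qed.

Lemma collision_of_few_diffs {A : {fset nat}} (ps : seq (nat * nat)) :
  A != fset0 -> (#|` diffset A| <= (size ps).*2)%N ->
  all (fun p => [&& p.1 \in A, p.2 \in A & (p.1 < p.2)%N]) ps ->
  ~~ uniq [seq (p.2 - p.1)%N | p <- ps].
Proof.
move=> A0 hD psA; apply/negP => /(diffset_ge_pairs A0 psA); lia.
Qed.

Ltac decide_pairs AE := rewrite /= !AE !inE !eqxx ?orbT /=; lia.

(** At most three positive differences: the three from [a] are all of them, so those from [b] to [c] and [d] must be the first two of
    them. *)
Lemma progression4 (A : {fset nat}) a b c d :
  A =i [:: a; b; c; d] -> (a < b < c)%N -> (c < d)%N -> (#|` diffset A| <= 8)%N ->
  exists x, [:: a; b; c; d] = [seq a + x * i | i <- iota 0 4]%N.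
Proof.
move=> AE habc hcd hD.
have A0 : A != fset0 by apply/fset0Pn; exists a; rewrite AE inE eqxx.
have /= := @collision_of_few_diffs A [:: (a, b); (a, c); (a, d); (b, c)] A0 hD ltac:(decide_pairs AE).
have /= := @collision_of_few_diffs A [:: (a, b); (a, c); (a, d); (b, d)] A0 hD ltac:(decide_pairs AE).
rewrite !inE => h1 h2; exists (b - a)%N.
by apply/eqP; rewrite /= !eqseq_cons eqxx; lia.
Qed.

(** At most four positive differences: the four from [a] are all of them. Those from [b] to [c], [d] and [e] are smaller than the last
    one and increasing, hence equal to the first three. *)
Lemma progression5 (A : {fset nat}) a b c d e :
  A =i [:: a; b; c; d; e] -> (a < b < c)%N -> (c < d < e)%N -> (#|` diffset A| <= 10)%N ->
  exists x, [:: a; b; c; d; e] = [seq a + x * i | i <- iota 0 5]%N.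
Proof.
move=> AE habc hcde hD.
have A0 : A != fset0 by apply/fset0Pn; exists a; rewrite AE inE eqxx.
have chain : uniq [:: b - a; c - a; d - a; e - a]%N by rewrite /= !inE; lia.
have from_a v : v \in [:: c; d; e] -> (v - b)%N \in [:: b - a; c - a; d - a; e - a]%N.
  move=> hv; apply: contraT => nin.
  have := @collision_of_few_diffs A [:: (b, v); (a, b); (a, c); (a, d); (a, e)] A0 hD.
  rewrite [uniq _]/= in chain; rewrite /= in nin; rewrite /= nin chain /= => -> //.
  by move: hv; rewrite !inE => /or3P [] /eqP ->; decide_pairs AE.
have := from_a c; have := from_a d; have := from_a e; rewrite !inE !eqxx ?orbT.
move=> /(_ isT) he /(_ isT) hd /(_ isT) hc.
have Ec : (c - b = b - a)%N by clear he hd; lia.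
have Ed : (d - b = c - a)%N by clear he; lia.
clear - habc hcde Ec Ed he.
by exists (b - a)%N; apply/eqP; rewrite /= !eqseq_cons eqxx; lia.
Qed.

(** For four points with gaps [x], [y], [z], the values [p], [q], [r] are the
    remaining differences and [t] is a larger one. Since [x < p < q < r < t]
    are five values and a sixth is excluded, [z] and [y] are among them; as
    [x < z < q] and [y < p], this forces [z = p] and [y = x]. *)
Lemma uneven_gaps (x y z p q r t : nat) :
  (0 < x)%N -> (0 < y)%N -> (x < z)%N ->
  p = (x + y)%N -> q = (y + z)%N -> r = (x + y + z)%N -> (r < t)%N ->
  ~~ uniq [:: z; x; p; q; r; t] -> ~~ uniq [:: y; x; p; q; r; t] ->
  y = x /\ z = x.*2.
Proof.
move=> x0 y0 xz pE qE rE rt.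
have chain : uniq [:: x; p; q; r; t] by rewrite /= !inE; lia.
rewrite !(cons_uniq _ [:: x; p; q; r; t]) chain !andbT !negbK !inE => hz hy.
have zE : z = p by clear hy chain; lia.
by clear hz chain; lia.
Qed.

(** With at most five positive differences, one of them beyond those of
    [a < b < c < d], these four points have at most four: the gaps are either
    symmetric or proportional to 1, 1, 2 or 2, 1, 1. *)
Lemma four_gaps (A : {fset nat}) (a b c d u v : nat) :
  (#|` diffset A| <= 12)%N -> all [in A] [:: a; b; c; d; u; v] ->
  (a < b < c)%N -> (c < d)%N -> (d - a < v - u)%N ->
  [\/ d - c = b - a, c - b = b - a /\ d - c = (b - a).*2
    | c - b = d - c /\ b - a = (d - c).*2]%N.
Proof.
move=> hD /and5P [aA bA cA dA /and3P [uA vA _]] habc hcd hT.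
have A0 : A != fset0 by apply/fset0Pn; exists a.
have nu (ps : seq (nat * nat)) : size ps = 6 ->
    all (fun p => [&& p.1 \in A, p.2 \in A & (p.1 < p.2)%N]) ps ->
    ~~ uniq [seq (p.2 - p.1)%N | p <- ps].
  by move=> s6; apply: collision_of_few_diffs => //; rewrite s6.
have ok : [/\ (a < c)%N, (b < d)%N, (a < d)%N & (u < v)%N] by split; lia.
case: ok => ac bd ad uv; case/andP: (habc) => ab bc.
have ok := (aA, bA, cA, dA, uA, vA, ab, bc, hcd, (ac, bd, ad, uv)).
have [xz|zx|] := ltngtP (b - a) (d - c); last by constructor 1.
- have h1 : ~~ uniq [seq (p.2 - p.1)%N | p <- [:: (c, d); (a, b); (a, c); (b, d); (a, d); (u, v)]].
    by apply: nu => //=; rewrite !ok.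
  have h2 : ~~ uniq [seq (p.2 - p.1)%N | p <- [:: (b, c); (a, b); (a, c); (b, d); (a, d); (u, v)]].
    by apply: nu => //=; rewrite !ok.
  by constructor 2; apply: uneven_gaps h1 h2; clear -habc hcd hT xz; rewrite /=; lia.
(* The reflection of the previous case. *)
- have h1 : ~~ uniq [seq (p.2 - p.1)%N | p <- [:: (a, b); (c, d); (b, d); (a, c); (a, d); (u, v)]].
    by apply: nu => //=; rewrite !ok.
  have h2 : ~~ uniq [seq (p.2 - p.1)%N | p <- [:: (b, c); (c, d); (b, d); (a, c); (a, d); (u, v)]].
    by apply: nu => //=; rewrite !ok.
  by constructor 3; apply: uneven_gaps h1 h2; clear -habc hcd hT zx; rewrite /=; lia.
Qed.

(** The first four and the last four points each omit the largest difference
    [e - a], so [four_gaps] applies to both. Combining the two descriptions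
    leaves six patterns, listed below, and each has at most 11 sums. *)
Lemma card_sumset5 (A : {fset nat}) a b c d e :
  A =i [:: a; b; c; d; e] -> (a < b < c)%N -> (c < d < e)%N -> (#|` diffset A| <= 12)%N ->
  (#|` sumset A| <= 11)%N.
Proof.
move=> AE habc hcde hD.
have A0 : A != fset0 by apply/fset0Pn; exists a; rewrite AE inE eqxx.
have L : [\/ d - c = b - a, c - b = b - a /\ d - c = (b - a).*2
    | c - b = d - c /\ b - a = (d - c).*2]%N.
  by apply: (@four_gaps A a b c d a e) => //; first (by rewrite /= !AE !inE !eqxx ?orbT); lia.
have R : [\/ e - d = c - b, d - c = c - b /\ e - d = (c - b).*2
    | d - c = e - d /\ c - b = (e - d).*2]%N.
  by apply: (@four_gaps A b c d e a e) => //; first (by rewrite /= !AE !inE !eqxx ?orbT); lia.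
(* Gaps x, y, x, y with x <> y would give the six differences
   x, y, x + y, 2x + y, x + 2y, 2x + 2y. *)
have even : (d - c = b - a)%N -> (e - d = c - b)%N -> (b - a = c - b)%N.
  move=> xz yw; apply/eqP; apply: contraT => xy.
  have := @collision_of_few_diffs A [:: (a, b); (b, c); (a, c); (a, d); (b, e); (a, e)]
    A0 hD ltac:(decide_pairs AE).
  suff -> : uniq [seq (p.2 - p.1)%N | p <- [:: (a, b); (b, c); (a, c); (a, d); (b, e); (a, e)]] by [].
  by rewrite /= !inE; clear -xy xz yw habc hcde; lia.
have shape x s : (size (undup [seq (i + j)%N | i <- s, j <- s]) <= 11)%N ->
    ([:: a; b; c; d; e] == [seq a + x * i | i <- s])%N -> (#|` sumset A| <= 11)%N.
  by move=> s11 /eqP E; rewrite E in AE; apply: leq_trans (card_sumset_affine AE) s11.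
clear -L R even habc hcde shape.
case: L => L; case: R => R; try have xy := even L R;
  first [ exfalso; clear shape; lia
        | by apply: (shape (b - a)%N [:: 0; 1; 2; 3; 4]) => //=; rewrite !eqseq_cons eqxx; lia
        | by apply: (shape (b - a)%N [:: 0; 1; 2; 3; 5]) => //=; rewrite !eqseq_cons eqxx; lia
        | by apply: (shape (b - a)%N [:: 0; 1; 2; 4; 5]) => //=; rewrite !eqseq_cons eqxx; lia
        | by apply: (shape (b - a)%N [:: 0; 1; 3; 4; 5]) => //=; rewrite !eqseq_cons eqxx; lia
        | by apply: (shape (c - b)%N [:: 0; 2; 3; 4; 5]) => //=; rewrite !eqseq_cons eqxx; lia
        | by apply: (shape (c - b)%N [:: 0; 2; 3; 4; 6]) => //=; rewrite !eqseq_cons eqxx; lia].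
Qed.

(** * Small sum-dominant sets *)

(** Sets with all sums distinct have n(n-1) + 1 >= n(n+1)/2 differences when
    n >= 1, and those with one coincidence have at least n(n-1) - 3
    differences, which is at least n(n+1)/2 - 1 when n is 4 or 5. *)
Lemma card_sumset_sum_dominant (A : {fset nat}) :
  (#|` A| < 6)%N -> sum_dominant A ->
  (2 * (#|` sumset A| + 1 + (3 < #|` A|)) <= #|` A| * (#|` A|).+1)%N.
Proof.
rewrite /sum_dominant => hA hdom.
have A0 : A != fset0.
  apply/eqP => A0; move: hdom; rewrite sumsetE A0.
  have -> : upairs fset0 = fset0 by apply/fsetP => p; rewrite !inE.
  by rewrite imfset0 cardfs0.
have := card_diffset_sidon A0; have := card_diffset_one_collision A0.
have hU : (#|` sumset A| <= #|` upairs A|)%N by rewrite sumsetE leq_imfset_card.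
move: hU hdom hA (card_upairs A) (card_offdiag A) A0; rewrite -cardfs_gt0.
move: #|` A| #|` sumset A| #|` diffset A| #|` upairs A| #|` offdiag A| => n S D U O.
move=> hU hDS hn cU cO n0 near sidon.
have nears : (S + 1 < U)%N || (O + 1 <= D + 4)%N by case: ltnP => // /near ->.
have sidons : (S < U)%N || (O + 1 <= D)%N by case: ltnP => // /sidon ->.
clear near sidon.
by case: n hn n0 cU cO => [|[|[|[|[|[|n]]]]]] //=; lia.
Qed.

Theorem theorem1 (A : {fset nat}) (hA : (#|` A| < 6)%N) : ~ sum_dominant A.
Proof.
move=> dom; have bound n : #|` A| = n -> (2 * (#|` sumset A| + 1 + (3 < n)) <= n * n.+1)%N.
  by move=> <-; apply: card_sumset_sum_dominant.
have {}dom : (#|` diffset A| < #|` sumset A|)%N := dom.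
have [s [so ss AE]] := fset_sorted A; rewrite -ss in hA.
case: s so ss hA AE => [|a s] so ss hA AE; first by have := bound 0%N (esym ss); lia.
have A0 : A != fset0 by apply/fset0Pn; exists a; rewrite AE inE eqxx.
have pairs ps := @diffset_ge_pairs A ps A0.
case: s so ss AE hA => [|b [|c [|d [|e [|]]]]] //= so ss AE hA; have {}bound := bound _ (esym ss).
- have : (0 < #|` diffset A|)%N := pairs [::] isT isT; lia.
- have : (2 < #|` diffset A|)%N := pairs [:: (a, b)] ltac:(decide_pairs AE) isT; lia.
- have : (4 < #|` diffset A|)%N := pairs [:: (a, b); (a, c)]
    ltac:(decide_pairs AE) ltac:(rewrite /= !inE; lia).
  lia.
- have D7 : (6 < #|` diffset A|)%N := pairs [:: (a, b); (a, c); (a, d)]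
    ltac:(decide_pairs AE) ltac:(rewrite /= !inE; lia).
  have [|||x E] := progression4 AE; try lia.
  rewrite E in AE; have : (#|` sumset A| <= 7)%N := card_sumset_affine AE; lia.
- have D9 : (8 < #|` diffset A|)%N := pairs [:: (a, b); (a, c); (a, d); (a, e)]
    ltac:(decide_pairs AE) ltac:(rewrite /= !inE; lia).
  have S11 : (#|` sumset A| <= 11)%N by apply: (card_sumset5 AE); lia.
  have [|||x E] := progression5 AE; try lia.
  rewrite E in AE; have : (#|` sumset A| <= 9)%N := card_sumset_affine AE; lia.
Qed.
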